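(* Let $n\ge 0$ and let $d\mu$ be a probability measure on the unit circle $S^1\subset\mathbb{C}$ such that either (i) the support of $d\mu$ is finite with $|\mathrm{supp}(d\mu)|\ge n+1$, or (ii) the Verblunsky coefficients of $d\mu$ are periodic with period $p\ge n+1$, $p$ even. Let $\{\cdot,\cdot\}$ denote the Poisson bracket in the Verblunsky coefficients corresponding to case (i) or (ii), as appropriate. Then the orthonormal polynomials $\phi_n$ and normalized second kind polynomials $\psi_n$, together with their reversed polynomials $\phi_n^*,\psi_n^*$, regarded as functions of the Verblunsky coefficients, satisfy for all $z\neq w$ in $\mathbb{C}$: $$\{\phi_n(z),\phi_n(w)\}=-\{\psi_n(z),\psi_n(w)\}=\frac{i}{4}\bigl(\phi_n(z)\psi_n(w)-\phi_n(w)\psi_n(z)\bigr),$$ $$\{\phi_n(z),\phi_n^*(w)\}=\frac{i}{4}\bigl[\phi_n(z)(\phi_n^*(w)-\psi_n^*(w))+(\phi_n(z)-\psi_n(z))\phi_n^*(w)\bigr]+\frac{iw}{z-w}\bigl(\phi_n(z)\phi_n^*(w)-\phi_n(w)\phi_n^*(z)\bigr),$$ $$\{\psi_n(z),\psi_n^*(w)\}=\frac{i}{4}\bigl[\psi_n(z)(\psi_n^*(w)-\phi_n^*(w))+(\psi_n(z)-\phi_n(z))\psi_n^*(w)\bigr]+\frac{iw}{z-w}\bigl(\psi_n(z)\psi_n^*(w)-\psi_n(w)\psi_n^*(z)\bigr),$$ $$\{\phi_n(z),\psi_n(w)\}=\frac{-iw}{z-w}\bigl(\phi_n(z)\psi_n(w)-\phi_n(w)\psi_n(z)\bigr)-\frac{i}{2}\bigl(\phi_n(z)-\psi_n(z)\bigr)\bigl(\phi_n(w)+\psi_n(w)\bigr)+\frac{i}{4}\bigl(\phi_n(z)\phi_n(w)-\psi_n(z)\psi_n(w)\bigr),$$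 $$\{\phi_n(z),\psi_n^*(w)\}=\frac{i}{4}\bigl[(\phi_n(z)-\psi_n(z))\phi_n^*(w)-\psi_n(z)(\phi_n^*(w)-\psi_n^*(w))\bigr]-\frac{iw}{z-w}\bigl(\psi_n(z)\phi_n^*(w)-\psi_n(w)\phi_n^*(z)\bigr).$$
   Context: Let $\mathbb{D}=\{z\in\mathbb{C}: |z|<1\}$. A probability measure $d\mu$ on $S^1$ has Verblunsky coefficients $\alpha_k$, defined by the recurrence for its monic orthogonal polynomials: $\Phi_0=\Phi_0^*=1$, $$\Phi_{k+1}(z)=z\Phi_k(z)-\bar\alpha_k\Phi_k^*(z),\qquad \Phi_{k+1}^*(z)=\Phi_k^*(z)-\alpha_k z\Phi_k(z),$$ where $\Phi_k^*(z)=z^k\,\overline{\Phi_k(1/\bar z)}$ is the reversed polynomial. If $d\mu$ is supported at exactly $N$ points, then $\alpha_0,\dots,\alpha_{N-2}\in\mathbb{D}$ and $\alpha_{N-1}\in S^1$; if the support is infinite, all $\alpha_k\in\mathbb{D}$. In both cases measures and coefficient sequences are in 1-1 correspondence. Thus $\Phi_n(z)=\Phi_n(z;\alpha_0,\dots,\alpha_{n-1})$ is a function of the Verblunsky coefficients, with $z\in\mathbb{C}$ a parameter. The second kind polynomials are $\Psi_n(z)=\Phi_n(z;-\alpha_0,\dots,-\alpha_{n-1})$, with reversed polynomials $\Psi_n^*(z)=z^n\,\overline{\Psi_n(1/\bar z)}$. Put $\rho_k=\sqrt{1-|\alpha_k|^2}$. The orthonormal and normalized second kind polynomials are $\phi_n=\bigl(\prod_{j=0}^{n-1}\rho_j^{-1}\bigr)\Phi_n$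 and $\psi_n=\bigl(\prod_{j=0}^{n-1}\rho_j^{-1}\bigr)\Psi_n$ (empty product $=1$), with reversed polynomials $\phi_n^*=\bigl(\prod_{j=0}^{n-1}\rho_j^{-1}\bigr)\Phi_n^*$ and $\psi_n^*=\bigl(\prod_{j=0}^{n-1}\rho_j^{-1}\bigr)\Psi_n^*$. For $\alpha=u+iv$ use $\partial/\partial\alpha=\frac12(\partial_u-i\partial_v)$, $\partial/\partial\bar\alpha=\frac12(\partial_u+i\partial_v)$. Poisson brackets: in the finite case ($N$ support points), for smooth functions $f,g$ on $\mathbb{D}^{N-1}\times S^1$, $$\{f,g\}=i\sum_{k=0}^{N-2}\rho_k^2\left[\frac{\partial f}{\partial\bar\alpha_k}\frac{\partial g}{\partial\alpha_k}-\frac{\partial f}{\partial\alpha_k}\frac{\partial g}{\partial\bar\alpha_k}\right];$$ in the periodic case with (even) period $p$, for smooth $f,g$ on $\mathbb{D}^p=\{(\alpha_0,\dots,\alpha_{p-1}):\alpha_j\in\mathbb{D}\}$, the same formula with the sum running over $0\le k\le p-1$. *)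

(* Defs.v *)
From HB Require Import structures.
From mathcomp Require Import all_boot all_order all_algebra.
From mathcomp Require Import complex.
From mathcomp Require Import all_classical all_reals all_analysis.
Import Order.TTheory GRing.Theory Num.Theory numFieldNormedType.Exports.

Set Implicit Arguments.
Unset Strict Implicit.
Unset Printing Implicit Defensive.

Local Open Scope classical_set_scope.
Local Open Scope ring_scope.
Local Open Scope complex_scope.
Local Open Scope card_scope.

(* The complex plane as a measurable and topological space is [plane R], with
   the product sigma-algebra (= Borel) and the product topology; a point (x, y)
   stands for the complex number x + iy. *)
Notation plane R := (measurableTypeR R * measurableTypeR R)%type.

Section Measures.
Variable R : realType.

Definition cpt (x : plane R) : R[i] := (x.1 : R) +i* (x.2 : R).

Definition unit_circle : set (plane R) := [set x | `|cpt x| = 1].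

Definition supp (mu : probability (plane R) R) : set (plane R) :=
  [set x | forall U : set (plane R), open U -> U x -> (0 < mu U)%E].

Definition circle_integral (mu : probability (plane R) R) (f : R[i] -> R[i]) :
    R[i] :=
  (\int[mu]_(x in unit_circle) complex.Re (f (cpt x)))%R +i*
  (\int[mu]_(x in unit_circle) complex.Im (f (cpt x)))%R.

Definition monic_orthogonal (mu : probability (plane R) R) (k : nat)
    (P : {poly R[i]}) : Prop :=
  [/\ P \is monic, size P = k.+1 &
      forall j, (j < k)%N ->
        circle_integral mu (fun z => (z ^+ j)^* * P.[z]) = 0].

End Measures.

Section Polynomials.
Variable R : realType.

(* The reversed polynomial z |-> z^n (P (1 / z^* ))^* of a P of degree at most
   n, with its value at z = 0 being that of the polynomial. *)
Definition revpoly (n : nat) (P : {poly R[i]}) : {poly R[i]} :=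
  \poly_(j < n.+1) (P`_(n - j))^*.

Fixpoint Phi (n : nat) (alpha : nat -> R[i]) : {poly R[i]} :=
  if n is k.+1 then
    'X * Phi k alpha - (alpha k)^* *: revpoly k (Phi k alpha)
  else 1.

Definition Psi (n : nat) (alpha : nat -> R[i]) : {poly R[i]} :=
  Phi n (fun k => - alpha k).

Definition rho (alpha : nat -> R[i]) (k : nat) : R :=
  Num.sqrt (1 - Normc.normc (alpha k) ^+ 2).

Definition normalization (n : nat) (alpha : nat -> R[i]) : R[i] :=
  (\prod_(j < n) (rho alpha j)^-1)%:C.

(* For fixed n and z these are functions of the Verblunsky coefficients. *)
Definition phi n (z : R[i]) (alpha : nat -> R[i]) : R[i] :=
  normalization n alpha * (Phi n alpha).[z].
Definition psi n (z : R[i]) (alpha : nat -> R[i]) : R[i] :=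
  normalization n alpha * (Psi n alpha).[z].
Definition phistar n (z : R[i]) (alpha : nat -> R[i]) : R[i] :=
  normalization n alpha * (revpoly n (Phi n alpha)).[z].
Definition psistar n (z : R[i]) (alpha : nat -> R[i]) : R[i] :=
  normalization n alpha * (revpoly n (Psi n alpha)).[z].

(* Phi k alpha is the degree k monic orthogonal polynomial of mu, for every k
   up to the number of points in the support of mu (for all k when the support
   is infinite). If the support has N points, this determines alpha_0, ...,
   alpha_(N-1) and leaves the irrelevant alpha_k with k >= N unconstrained. *)
Definition verblunsky (mu : probability (plane R) R) (alpha : nat -> R[i]) :
    Prop :=
  forall k : nat, `I_k #<= supp mu -> monic_orthogonal mu k (Phi k alpha).

End Polynomials.

Section Poisson.
Variable R : realType.

(* A function on D^(N-1) x S^1 or D^p is represented as a function of the whole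
   sequence alpha that depends only on its first N, resp. p, entries. *)
Implicit Types (f g : (nat -> R[i]) -> R[i]) (alpha : nat -> R[i]).

Definition shift_coord alpha (k : nat) (h : R[i]) : nat -> R[i] :=
  fun j => if j == k then alpha j + h else alpha j.

Definition deriv_at0 (F : R -> R[i]) : R[i] :=
  derive1 (fun t : R => complex.Re (F t)) 0 +i*
  derive1 (fun t : R => complex.Im (F t)) 0.

Definition d_u f k alpha : R[i] :=
  deriv_at0 (fun t => f (shift_coord alpha k t%:C)).
Definition d_v f k alpha : R[i] :=
  deriv_at0 (fun t => f (shift_coord alpha k ('i * t%:C))).

Definition d_alpha f k alpha : R[i] :=
  2^-1 * (d_u f k alpha - 'i * d_v f k alpha).
Definition d_alphabar f k alpha : R[i] :=
  2^-1 * (d_u f k alpha + 'i * d_v f k alpha).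

Definition poisson (m : nat) f g alpha : R[i] :=
  'i * \sum_(k < m) (rho alpha k ^+ 2)%:C *
    (d_alphabar f k alpha * d_alpha g k alpha -
     d_alpha f k alpha * d_alphabar g k alpha).

(* On D^(N-1) x S^1 only alpha_0, ..., alpha_(N-2) enter the bracket. *)
Definition poisson_finite (N : nat) := poisson N.-1.

Definition poisson_periodic (p : nat) := poisson p.

End Poisson.

(* Main.v *)
Require Import Defs.
From HB Require Import structures.
From mathcomp Require Import all_boot all_order all_algebra.
From mathcomp Require Import complex ring.
From mathcomp Require Import all_classical all_reals all_analysis.
Import Order.TTheory GRing.Theory Num.Theory numFieldNormedType.Exports.

Local Open Scope classical_set_scope.
Local Open Scope ring_scope.
Local Open Scope complex_scope.
Local Open Scope card_scope.

(** One step of the Szego recurrence multiplies the column (phi_k, phi_k^* )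
    by the matrix L_k(z) = rho_k^-1 [[z, - conj alpha_k], [- alpha_k z, 1]], and
    the column (psi_k, - psi_k^* ) by the same matrix.  With the transfer matrix
    T_n(z) = L_(n-1)(z) ... L_0(z), the polynomials phi_n and phi_n^* are thus
    the entries of T_n(z) (1, 1)^T, while psi_n and - psi_n^* are those of
    T_n(z) (1, -1)^T, and all the brackets can be read off the brackets between
    the entries of T_n(z) and those of T_n(w).

    The latter have a closed form, the Sklyanin relation
      { T_n(z) (x) T_n(w) } = [ r(z, w), T_n(z) (x) T_n(w) ],
    where r(z, w) is the trigonometric r-matrix.  Identify C^2 (x) C^2 with the
    2 x 2 matrices X, so that S (x) T acts as X |-> S X T^T, and let r act by
    [rmat].  The bracket applied to X is then
      i sum_k rho_k^2 (dbar_k T(z) X d_k T(w)^T - d_k T(z) X dbar_k T(w)^T),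
    and the relation says that it equals r(T(z) X T(w)^T) - T(z) r(X) T(w)^T.

    This form of the relation is inherited by products.  As L_n depends only on
    alpha_n and T_n only on the previous coefficients, the Leibniz rule gives
      { T_(n+1) } = L_n { T_n } L_n^T + { L_n } applied to T_n X T_n^T;
    when both brackets on the right are commutators with r, the two middle terms
    cancel and a commutator with r remains ([transfer_sklyanin]).  So only one
    factor has to be computed, which is an identity of rational functions
    ([szego_sklyanin]).

    The brackets being defined by real derivatives along the two axes of each
    alpha_k, the Wirtinger derivatives of T_n come from a small calculus
    ([wirtinger]) closed under sums and products and containing the coordinate,
    its conjugate and 1 / rho_k.  Finally both brackets of the theorem sum over
    indices k < m for some m >= n, and the terms with k >= n vanish. *)

Set Implicit Arguments.
Unset Strict Implicit.
Unset Printing Implicit Defensive.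

(** * The trigonometric r-matrix and the Szego matrix *)

Section RMatrix.
Variable F : fieldType.

Definition mat2 (a b c d : F) : 'M[F]_2 :=
  \matrix_(i, j) if i == 0 then (if j == 0 then a else b)
                 else (if j == 0 then c else d).

Lemma ord2P (i : 'I_2) : i = 0 \/ i = 1.
Proof. by case: i => [[|[|//]]] i2; [left | right]; apply/val_inj. Qed.

Lemma mat2P (A B : 'M[F]_2) :
  A 0 0 = B 0 0 -> A 0 1 = B 0 1 -> A 1 0 = B 1 0 -> A 1 1 = B 1 1 -> A = B.
Proof.
by move=> h00 h01 h10 h11; apply/matrixP => i j;
  case: (ord2P i) => ->; case: (ord2P j) => ->.
Qed.

Lemma mulmx2E m p (A : 'M[F]_(m, 2)) (B : 'M[F]_(2, p)) i j :
  (A *m B) i j = A i 0 * B 0 j + A i 1 * B 1 j.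
Proof.
rewrite mxE big_ord_recl big_ord1.
by congr (_ + A _ _ * B _ _); apply/val_inj.
Qed.

(** The action on X, standing for the tensor sum of the X i j e_i (x) e_j, of
    the r-matrix c / (2 (z - w)) times [[z + w, - 2 w], [- 2 z, z + w]] on the
    span of e_0 (x) e_1 and e_1 (x) e_0, and zero on e_0 (x) e_0 and
    e_1 (x) e_1.  The constant c will be the imaginary unit.  A multiple of the
    identity may be added to r without changing commutators. *)
Definition rmat (c z w : F) (X : 'M[F]_2) : 'M[F]_2 :=
  mat2 0 (c / (2 * (z - w)) * ((z + w) * X 0 1 - 2 * w * X 1 0))
       (c / (2 * (z - w)) * ((z + w) * X 1 0 - 2 * z * X 0 1)) 0.

Lemma rmatZ c z w x X : rmat c z w (x *: X) = x *: rmat c z w X.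
Proof. by apply: mat2P; rewrite !mxE /=; ring. Qed.

Lemma rmat0 c z w : rmat c z w 0 = 0.
Proof. by have := rmatZ c z w 0 0; rewrite !scale0r. Qed.

(** The parameter b stands for the complex conjugate of a: with a and b
    independent, the Wirtinger derivatives are partial derivatives and the
    one-step relation is algebraic over any field. *)
Definition szego (z a b : F) : 'M[F]_2 := mat2 z (- b) (- (a * z)) 1.

(** For r = (1 - a b)^(-1/2), the derivatives of r [szego z a b] with respect
    to a and b are r [dszego z a b] and r [dbszego z a b]: the first summand
    comes from the derivative of r. *)
Definition dszego (z a b : F) : 'M[F]_2 :=
  (b / (2 * (1 - a * b))) *: szego z a b + mat2 0 0 (- z) 0.

Definition dbszego (z a b : F) : 'M[F]_2 :=
  (a / (2 * (1 - a * b))) *: szego z a b + mat2 0 (- 1) 0 0.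

(** The one computation of the proof.  The multiples of the Szego matrix in the
    two derivatives, which come from 1 / rho, cancel against each other by
    skew-symmetry; what remains are the brackets of a with b and of each of them
    with 1 / rho. *)
Lemma szego_sklyanin (c z w a b : F) (Y : 'M[F]_2) :
  (2 : F) != 0 -> z != w -> 1 - a * b != 0 ->
  (c * (1 - a * b)) *:
    (dbszego z a b *m Y *m (dszego w a b)^T -
     dszego z a b *m Y *m (dbszego w a b)^T) =
  rmat c z w (szego z a b *m Y *m (szego w a b)^T) -
  szego z a b *m rmat c z w Y *m (szego w a b)^T.
Proof.
move=> n2 zw nab; have zw' : z - w != 0 by rewrite subr_eq0.
apply: mat2P; rewrite !(mulmx2E, mxE) /=; field; by rewrite n2 zw' nab.
Qed.

(** Both sides are quadratic in the Szego matrix, so its normalization r = 1/rho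
    enters through the common factor r^2. *)
Lemma szego_sklyanin_scaled (c z w a b r : F) (Y : 'M[F]_2) :
  (2 : F) != 0 -> z != w -> 1 - a * b != 0 ->
  (c * (1 - a * b)) *:
    ((r *: dbszego z a b) *m Y *m (r *: dszego w a b)^T -
     (r *: dszego z a b) *m Y *m (r *: dbszego w a b)^T) =
  rmat c z w ((r *: szego z a b) *m Y *m (r *: szego w a b)^T) -
  (r *: szego z a b) *m rmat c z w Y *m (r *: szego w a b)^T.
Proof.
move=> n2 zw nab.
have scale2 (A B Z : 'M[F]_2) :
    (r *: A) *m Z *m (r *: B)^T = (r * r) *: (A *m Z *m B^T).
  by rewrite linearZ /= -!scalemxAl -scalemxAr scalerA.
rewrite !scale2 rmatZ -!scalerBr -szego_sklyanin // !scalerA.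
by congr (_ *: _); ring.
Qed.

Lemma scaled_affineE (r x : F) (A B : 'M[F]_2) i j :
  (r *: (x *: A + B)) i j = r * x * A i j + r * B i j.
Proof. by rewrite !mxE mulrDr mulrA. Qed.

(** The action of S (x) T on C^2 (x) C^2 is multiplicative; this and the next
    lemmas are the rewriting steps of the induction on the number of factors,
    stated over an abstract field. *)
Lemma sandwichM (A B S T X : 'M[F]_2) :
  A *m S *m X *m (B *m T)^T = A *m (S *m X *m T^T) *m B^T.
Proof. by rewrite trmx_mul !mulmxA. Qed.

Lemma scaled_sandwich0 (c z w : F) (A B D Y : 'M[F]_2) :
  (c * 0) *: D = rmat c z w ((0 *: A) *m Y *m (0 *: B)^T) -
                 (0 *: A) *m rmat c z w Y *m (0 *: B)^T.
Proof. by rewrite mulr0 !scale0r !mul0mx rmat0 subr0. Qed.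

(** The commutators with r telescope: with Z = r(Y), W = r(X) and V = r(L Y M^T)
    this is L [r, S (x) T] + [r, L (x) M] (S (x) T) = [r, L S (x) M T]. *)
Lemma sandwich_cancel (L M S T V W Z : 'M[F]_2) :
  L *m (Z - S *m W *m T^T) *m M^T + (V - L *m Z *m M^T) =
  V - L *m S *m W *m (M *m T)^T.
Proof.
by rewrite sandwichM mulmxBr mulmxBl addrC addrA subrK.
Qed.

Lemma sandwich_skew (c : F) (P Q A B D E X : 'M[F]_2) :
  c *: (P *m A *m X *m (Q *m B)^T - P *m D *m X *m (Q *m E)^T) =
  P *m (c *: (A *m X *m B^T - D *m X *m E^T)) *m Q^T.
Proof.
by rewrite !trmx_mul -scalemxAr -scalemxAl mulmxBr mulmxBl !mulmxA.
Qed.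

Lemma sandwich0 (c : F) (P Q B E X : 'M[F]_2) :
  P *m (c *: (0 *m X *m B^T - 0 *m X *m E^T)) *m Q^T = 0.
Proof. by rewrite !mul0mx subrr scaler0 mulmx0 mul0mx. Qed.

Definition col2 (x y : F) : 'cV[F]_2 := \col_i (if i == 0 then x else y).

Lemma col2E x y : (col2 x y 0 0 = x) * (col2 x y 1 0 = y).
Proof. by rewrite !mxE. Qed.

Lemma mulmx_col2 (S : 'M[F]_2) x y i :
  (S *m col2 x y) i 0 = S i 0 * x + S i 1 * y.
Proof. by rewrite mulmx2E !mxE. Qed.

Lemma rmat_outerE (c z w : F) (p q : 'cV[F]_2) :
  rmat c z w (p *m q^T) =
  mat2 0
    (c / (2 * (z - w)) * ((z + w) * (p 0 0 * q 1 0) - 2 * w * (p 1 0 * q 0 0)))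
    (c / (2 * (z - w)) * ((z + w) * (p 1 0 * q 0 0) - 2 * z * (p 0 0 * q 1 0)))
    0.
Proof. by rewrite /rmat !(mxE, big_ord1). Qed.

Lemma mat2E (x y s t : F) :
  (mat2 x y s t 0 0 = x) * (mat2 x y s t 0 1 = y) *
  (mat2 x y s t 1 0 = s) * (mat2 x y s t 1 1 = t).
Proof. by rewrite !mxE. Qed.

(** The two entries that are needed: the action of r on the left annihilates
    the diagonal entry and mixes the off-diagonal ones. *)
Lemma rmat_commutatorE (c z w : F) (S T : 'M[F]_2) u0 u1 v0 v1 :
  let D := rmat c z w (S *m (col2 u0 u1 *m (col2 v0 v1)^T) *m T^T) -
           S *m rmat c z w (col2 u0 u1 *m (col2 v0 v1)^T) *m T^T in
  let k := c / (2 * (z - w)) in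
  let x := k * ((z + w) * (u0 * v1) - 2 * w * (u1 * v0)) in
  let y := k * ((z + w) * (u1 * v0) - 2 * z * (u0 * v1)) in
  let p := S *m col2 u0 u1 in let q := T *m col2 v0 v1 in
  D 0 0 = - (S 0 0 * T 0 1 * x + S 0 1 * T 0 0 * y) /\
  D 0 1 = k * ((z + w) * (p 0 0 * q 1 0) - 2 * w * (p 1 0 * q 0 0)) -
          (S 0 0 * T 1 1 * x + S 0 1 * T 1 0 * y).
Proof.
move=> D k x y p q.
have DE i j : D i j = rmat c z w (p *m q^T) i j -
    (S i 0 * T j 1 * x + S i 1 * T j 0 * y).
  rewrite /D mxE [X in _ + X]mxE; congr (_ - _).
    by rewrite /p /q trmx_mul !mulmxA.
  rewrite rmat_outerE !mulmx2E !mat2E ![T^T _ _]mxE !col2E -/k -/x -/y; ring.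
by rewrite !DE rmat_outerE !mat2E sub0r.
Qed.

End RMatrix.

(** * Derivatives of complex functions of a real variable *)

Section ComplexDerivative.
Variable R : realType.
Local Notation C := R[i].

Definition is_cderive (f : R -> C) (d : C) : Prop :=
  is_derive (0 : R) 1 (fun t => complex.Re (f t)) (complex.Re d) /\
  is_derive (0 : R) 1 (fun t => complex.Im (f t)) (complex.Im d).

Lemma is_cderive_deriv_at0 f d : is_cderive f d -> deriv_at0 f = d.
Proof.
case=> hr hi; rewrite /deriv_at0 !derive1E !derive_val; by case: d {hr hi}.
Qed.

Lemma is_cderive_eq f d d' : is_cderive f d -> d = d' -> is_cderive f d'.
Proof. by move=> fd <-. Qed.

Lemma is_cderive_cst c : is_cderive (fun=> c) 0.
Proof. by split; exact: is_derive_cst. Qed.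

Lemma is_cderiveD f g df dg : is_cderive f df -> is_cderive g dg ->
  is_cderive (fun t => f t + g t) (df + dg).
Proof.
have ReD (x y : C) : complex.Re (x + y) = complex.Re x + complex.Re y
  by case: x y => ? ? [].
have ImD (x y : C) : complex.Im (x + y) = complex.Im x + complex.Im y
  by case: x y => ? ? [].
move=> [fr fi] [gr gi]; split.
  by under eq_fun do rewrite ReD; rewrite ReD; exact: is_deriveD.
by under eq_fun do rewrite ImD; rewrite ImD; exact: is_deriveD.
Qed.

Lemma is_cderiveM f g df dg : is_cderive f df -> is_cderive g dg ->
  is_cderive (fun t => f t * g t) (df * g 0 + f 0 * dg).
Proof.
have ReM (x y : C) : complex.Re (x * y) =
    complex.Re x * complex.Re y - complex.Im x * complex.Im y
  by case: x y => ? ? [].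
have ImM (x y : C) : complex.Im (x * y) =
    complex.Re x * complex.Im y + complex.Im x * complex.Re y
  by case: x y => ? ? [].
move=> [fr fi] [gr gi]; split.
  under eq_fun do rewrite ReM.
  apply: (is_derive_eq (is_deriveB (is_deriveM fr gr) (is_deriveM fi gi))).
  case: (f 0) (g 0) df dg {fr fi gr gi} => a b [a' b'] [c d] [c' d'] /=.
  rewrite /GRing.scale /=; ring.
under eq_fun do rewrite ImM.
apply: (is_derive_eq (is_deriveD (is_deriveM fr gi) (is_deriveM fi gr))).
case: (f 0) (g 0) df dg {fr fi gr gi} => a b [a' b'] [c d] [c' d'] /=.
rewrite /GRing.scale /=; ring.
Qed.

Lemma is_derive_affine (x u : R) : is_derive (0 : R) 1 (fun t => x + t * u) u.
Proof.
have h := is_deriveD (is_derive_cst x (0 : R) 1)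
  (is_deriveM (is_derive_id (0 : R) 1) (is_derive_cst u (0 : R) 1)).
apply: (is_derive_eq h).
rewrite /GRing.scale /=; ring.
Qed.

(** The derivative of 1 / rho at the point x + i y in the direction u + i v. *)
Lemma is_derive_rhoV (x y : R) (u v : R) : 0 < 1 - (x ^+ 2 + y ^+ 2) ->
  is_derive (0 : R) 1
    (fun t => (Num.sqrt (1 - ((x + t * u) ^+ 2 + (y + t * v) ^+ 2)))^-1)
    ((x * u + y * v) / Num.sqrt (1 - (x ^+ 2 + y ^+ 2)) ^+ 3).
Proof.
move=> s0.
pose q (t : R) := 1 - ((x + t * u) ^+ 2 + (y + t * v) ^+ 2).
have q0 : q 0 = 1 - (x ^+ 2 + y ^+ 2) by rewrite /q !mul0r !addr0.
have dq : is_derive (0 : R) 1 q (- (2 * (x * u + y * v))).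
  have du := is_derive_affine x u; have dv := is_derive_affine y v.
  rewrite /q; under eq_fun do rewrite !expr2.
  have h := is_deriveB (is_derive_cst (1 : R) (0 : R) 1)
    (is_deriveD (is_deriveM du du) (is_deriveM dv dv)).
  apply: (is_derive_eq h).
  rewrite /GRing.scale /=; ring.
have dr : is_derive (0 : R) 1 (Num.sqrt \o q)
    ((2 * Num.sqrt (q 0))^-1 * (- (2 * (x * u + y * v)))).
  apply: is_derive1_comp; apply: is_derive1_sqrt; by rewrite q0.
have r0 : Num.sqrt (1 - (x ^+ 2 + y ^+ 2)) != 0 by rewrite gt_eqF// sqrtr_gt0.
have r0' : (Num.sqrt \o q) 0 != 0 by rewrite /= q0.
apply: DeriveDef.
  by apply: derivableV.
rewrite [LHS](deriveV r0') // derive_val /= q0 /GRing.scale /=.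
by field.
Qed.

End ComplexDerivative.

(** * Wirtinger calculus *)

Section Wirtinger.
Variable R : realType.
Local Notation C := R[i].
Implicit Types (f g : (nat -> C) -> C) (a : nat -> C).

(** The derivatives of f along the axes of alpha_k are determined by the pair
    (df, dbf) of its Wirtinger derivatives, as d_u = d + dbar and
    d_v = i (d - dbar); in terms of this pair the rules of calculus are those
    of two independent derivations. *)
Definition wirtinger k a f (df dbf : C) : Prop :=
  is_cderive (fun t => f (shift_coord a k t%:C)) (df + dbf) /\
  is_cderive (fun t => f (shift_coord a k ('i * t%:C))) ('i * (df - dbf)).

Let ii : 'i * 'i = -1 :> C.
Proof. by rewrite -expr2 sqr_i. Qed.

Lemma shift_coord0 a k : shift_coord a k 0 = a.
Proof. by apply/funext => j; rewrite /shift_coord addr0 if_same. Qed.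

Lemma shift_coord_eq a k h : shift_coord a k h k = a k + h.
Proof. by rewrite /shift_coord eqxx. Qed.

Lemma shift_coord_neq a k h j : j != k -> shift_coord a k h j = a j.
Proof. by rewrite /shift_coord => /negPf ->. Qed.

Lemma wirtinger_d_alpha k a f df dbf :
  wirtinger k a f df dbf -> d_alpha f k a = df.
Proof.
case=> /is_cderive_deriv_at0 hu /is_cderive_deriv_at0 hv.
rewrite /d_alpha /d_u /d_v hu hv mulrA ii; field; by rewrite ?pnatr_eq0.
Qed.

Lemma wirtinger_d_alphabar k a f df dbf :
  wirtinger k a f df dbf -> d_alphabar f k a = dbf.
Proof.
case=> /is_cderive_deriv_at0 hu /is_cderive_deriv_at0 hv.
rewrite /d_alphabar /d_u /d_v hu hv mulrA ii; field; by rewrite ?pnatr_eq0.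
Qed.

Lemma wirtinger_cst k a f :
  (forall h, f (shift_coord a k h) = f a) -> wirtinger k a f 0 0.
Proof.
move=> fk; rewrite /wirtinger addr0 subr0 mulr0.
by split; under eq_fun do rewrite fk; exact: is_cderive_cst.
Qed.

Lemma wirtingerD k a f g df dbf dg dbg :
  wirtinger k a f df dbf -> wirtinger k a g dg dbg ->
  wirtinger k a (fun x => f x + g x) (df + dg) (dbf + dbg).
Proof.
move=> [fu fv] [gu gv]; split.
  by rewrite addrACA; exact: is_cderiveD.
by rewrite opprD addrACA mulrDr; exact: is_cderiveD.
Qed.

Lemma wirtingerM k a f g df dbf dg dbg :
  wirtinger k a f df dbf -> wirtinger k a g dg dbg ->
  wirtinger k a (fun x => f x * g x) (df * g a + f a * dg)
    (dbf * g a + f a * dbg).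
Proof.
move=> [fu fv] [gu gv].
have := is_cderiveM fu gu; have := is_cderiveM fv gv.
rewrite mulr0 shift_coord0 => hv hu; split.
  by apply: (is_cderive_eq hu); ring.
by apply: (is_cderive_eq hv); ring.
Qed.

Lemma is_cderive_lin (x : C) u : is_cderive (fun t => x + u * t%:C) u.
Proof.
case: x u => x y [u v]; split => /=.
  under eq_fun do rewrite mulr0 subr0 mulrC; exact: is_derive_affine.
by under eq_fun do rewrite mulr0 add0r mulrC; exact: is_derive_affine.
Qed.

Lemma wirtinger_coord k a : wirtinger k a (fun x => x k) 1 0.
Proof.
split; under eq_fun do rewrite shift_coord_eq.
  rewrite addr0; under eq_fun do rewrite -[X in _ + X]mul1r.
  exact: is_cderive_lin.
by rewrite subr0 mulr1; exact: is_cderive_lin.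
Qed.

Lemma wirtinger_conj_coord k a : wirtinger k a (fun x => conjc (x k)) 0 1.
Proof.
have line (u : C) : is_cderive
    (fun t => (shift_coord a k (u * t%:C) k)^*) (u^*).
  under eq_fun do rewrite shift_coord_eq rmorphD rmorphM /= oppr0.
  exact: is_cderive_lin.
split; last by apply: (is_cderive_eq (line 'i)); simpc.
under eq_fun => t do rewrite -[t%:C]mul1r.
by apply: (is_cderive_eq (line 1)); simpc.
Qed.

(** The hypothesis amounts to |alpha_k| < 1, the square root being 0 on
    nonpositive numbers. *)
Lemma sqr_rho a k : rho a k != 0 -> (rho a k ^+ 2)%:C = 1 - a k * conjc (a k).
Proof.
rewrite /rho sqrtr_eq0 -ltNge => /ltW /sqr_sqrtr ->.
case: (a k) => x y /=; rewrite sqr_sqrtr ?addr_ge0 ?sqr_ge0//.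
by apply/eqP; rewrite eq_complex /=; apply/andP; split; apply/eqP; ring.
Qed.

Lemma wirtinger_rhoV k a : rho a k != 0 ->
  wirtinger k a (fun x => ((rho x k)^-1)%:C)
    ((rho a k)^-1%:C * (conjc (a k) / (2 * (1 - a k * conjc (a k)))))
    ((rho a k)^-1%:C * (a k / (2 * (1 - a k * conjc (a k))))).
Proof.
move=> r0; rewrite -(sqr_rho r0) rmorphXn.
have rE h : rho (shift_coord a k h) k =
    Num.sqrt (1 - ((complex.Re (a k) + complex.Re h) ^+ 2 +
                   (complex.Im (a k) + complex.Im h) ^+ 2)).
  rewrite /rho shift_coord_eq; case: (a k) h => x y [u v] /=.
  by rewrite sqr_sqrtr ?addr_ge0 ?sqr_ge0.
have rE0 : rho a k =
    Num.sqrt (1 - (complex.Re (a k) ^+ 2 + complex.Im (a k) ^+ 2)).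
  by rewrite -{1}(shift_coord0 a k) rE !addr0.
have pos : 0 < 1 - (complex.Re (a k) ^+ 2 + complex.Im (a k) ^+ 2).
  by move: r0; rewrite rE0 sqrtr_eq0 -ltNge.
(* Both axes are covered by the direction u, taken to be 1 and i below. *)
have dir (u : C) : is_cderive
    (fun t => ((rho (shift_coord a k (u * t%:C)) k)^-1)%:C)
    ((complex.Re (a k) * complex.Re u + complex.Im (a k) * complex.Im u) /
      rho a k ^+ 3)%:C.
  split => /=; last exact: is_derive_cst.
  rewrite rE0; under eq_fun => t do rewrite rE.
  have := is_derive_rhoV (complex.Re u) (complex.Im u) pos.
  congr is_derive; apply/funext => t.
  by case: u => u v /=; rewrite !mulr0 subr0 add0r ![_ * t]mulrC.
have r0' : (rho a k)%:C != 0 :> C by rewrite fmorph_eq0.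
have aE : a k = (complex.Re (a k))%:C + 'i * (complex.Im (a k))%:C.
  exact: complexE.
have aJ : conjc (a k) = (complex.Re (a k))%:C - 'i * (complex.Im (a k))%:C.
  by case: (a k) => x y; simpc.
move: (complex.Re (a k)) (complex.Im (a k)) aE aJ dir {rE rE0 pos} => x y.
move=> aE aJ dir; rewrite aJ aE.
split.
  have h := dir 1; under eq_fun => t do rewrite -[t%:C]mul1r.
  apply: (is_cderive_eq h).
  rewrite mulr1 mulr0 addr0 !(rmorphM, fmorphV, rmorphXn) /=.
  by field; rewrite r0'.
apply: (is_cderive_eq (dir 'i)).
rewrite mulr1 mulr0 add0r !(rmorphM, fmorphV, rmorphXn) /=.
transitivity (- ('i * 'i) * y%:C / (rho a k)%:C ^+ 3).
  by rewrite ii opprK mul1r.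
by field; rewrite r0'.
Qed.

End Wirtinger.

(** * The Sklyanin relation for the transfer matrix *)

Section Transfer.
Variable R : realType.
Local Notation C := R[i].
Implicit Types (a : nat -> C) (z w : C).

(** The parameter B is [szego] or one of its two derivatives. *)
Definition step (B : C -> C -> C -> 'M[C]_2) n z a : 'M[C]_2 :=
  ((rho a n)^-1)%:C *: B z (a n) (conjc (a n)).

Fixpoint transfer n z a : 'M[C]_2 :=
  if n is m.+1 then step (@szego C) m z a *m transfer m z a else 1%:M.

(** Differentiating T_n with respect to alpha_k replaces its factor L_k by the
    derivative of L_k, which B describes; the result is 0 for k >= n. *)
Fixpoint dtransfer B n z k a : 'M[C]_2 :=
  if n is m.+1 then
    if k == m then step B m z a *m transfer m z a
    else step (@szego C) m z a *m dtransfer B m z k a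
  else 0.

Lemma dtransfer_ge B n z k a : (n <= k)%N -> dtransfer B n z k a = 0.
Proof.
elim: n => //= n IHn nk; rewrite gtn_eqF // IHn ?mulmx0 //; exact: ltnW.
Qed.

Definition wirtinger_mx p k a (A : (nat -> C) -> 'M[C]_(2, p))
    (dA dbA : 'M[C]_(2, p)) : Prop :=
  forall i j, wirtinger k a (fun x => A x i j) (dA i j) (dbA i j).

Lemma wirtinger_mxM p k a A dA dbA (B : (nat -> C) -> 'M[C]_(2, p)) dB dbB :
  wirtinger_mx k a A dA dbA -> wirtinger_mx k a B dB dbB ->
  wirtinger_mx k a (fun x => A x *m B x) (dA *m B a + A a *m dB)
    (dbA *m B a + A a *m dbB).
Proof.
move=> hA hB i j.
have h := wirtingerD (wirtingerM (hA i 0) (hB 0 j))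
  (wirtingerM (hA i 1) (hB 1 j)).
under eq_fun => x do rewrite mulmx2E.
move: h; congr wirtinger; rewrite mxE !mulmx2E; ring.
Qed.

Lemma wirtinger_mx_cst p k a (A : (nat -> C) -> 'M[C]_(2, p)) :
  (forall h, A (shift_coord a k h) = A a) -> wirtinger_mx k a A 0 0.
Proof.
by move=> hA i j; rewrite !mxE; apply: wirtinger_cst => h; rewrite hA.
Qed.

Lemma step_shift B n z a k h : n != k ->
  step B n z (shift_coord a k h) = step B n z a.
Proof. by move=> nk; rewrite /step /rho !shift_coord_neq. Qed.

Lemma transfer_shift n z a k h : (n <= k)%N ->
  transfer n z (shift_coord a k h) = transfer n z a.
Proof.
elim: n => //= n IHn nk; rewrite step_shift ?IHn ?ltn_eqF //; exact: ltnW.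
Qed.

Lemma wirtinger_step n z a : rho a n != 0 ->
  wirtinger_mx n a (step (@szego C) n z) (step (@dszego C) n z a)
    (step (@dbszego C) n z a).
Proof.
move=> r0.
have e : wirtinger_mx n a (fun x => szego z (x n) (conjc (x n)))
    (mat2 0 0 (- z) 0) (mat2 0 (- 1) 0 0).
  have c (x : C) : wirtinger n a (fun=> x) 0 0 by exact: wirtinger_cst.
  have cM (x : C) f df dbf : wirtinger n a f df dbf ->
      wirtinger n a (fun y => x * f y) (x * df) (x * dbf).
    by move/(wirtingerM (c x)); rewrite !mul0r !add0r.
  move=> i j; case: (ord2P i) => ->; case: (ord2P j) => ->;
    under eq_fun do rewrite mxE /=;
    rewrite !mxE /=.
  - exact: c.
  - have := cM (-1) _ _ _ (wirtinger_conj_coord n a).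
    by under eq_fun do rewrite mulN1r; rewrite mulr0 mulr1.
  - have := cM (- z) _ _ _ (wirtinger_coord n a).
    by under eq_fun do rewrite mulNr mulrC; rewrite mulr0 mulr1.
  - exact: c.
move=> i j; have := wirtingerM (wirtinger_rhoV r0) (e i j).
rewrite /step /dszego /dbszego !scaled_affineE.
by under [X in _ -> wirtinger _ _ X _ _]eq_fun => x do rewrite mxE.
Qed.

(** Only the factor that depends on alpha_k is differentiated, whence a condition
    on rho_k alone. *)
Lemma wirtinger_transfer n z k a : rho a k != 0 ->
  wirtinger_mx k a (transfer n z) (dtransfer (@dszego C) n z k a)
    (dtransfer (@dbszego C) n z k a).
Proof.
move=> r0; elim: n => [|n IHn] /=; first exact: wirtinger_mx_cst.
have [kn|kn] := eqVneq k n.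
  rewrite kn in r0 *.
  have c : wirtinger_mx n a (transfer n z) 0 0.
    by apply: wirtinger_mx_cst => h; rewrite transfer_shift.
  by have := wirtinger_mxM (wirtinger_step z r0) c; rewrite !mulmx0 !addr0.
have c : wirtinger_mx k a (step (@szego C) n z) 0 0.
  by apply: wirtinger_mx_cst => h; rewrite step_shift // eq_sym.
by have := wirtinger_mxM c IHn; rewrite !mul0mx !add0r.
Qed.

(** The contribution of alpha_k to the bracket of T_n(z) (x) T_n(w), as an
    operator applied to X. *)
Definition bracket_term n z w a (X : 'M[C]_2) k : 'M[C]_2 :=
  ('i * (rho a k ^+ 2)%:C) *:
    (dtransfer (@dbszego C) n z k a *m X *m (dtransfer (@dszego C) n w k a)^T -
     dtransfer (@dszego C) n z k a *m X *m (dtransfer (@dbszego C) n w k a)^T).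

Lemma step_sklyanin n z w a X : z != w ->
  ('i * (rho a n ^+ 2)%:C) *:
    (step (@dbszego C) n z a *m X *m (step (@dszego C) n w a)^T -
     step (@dszego C) n z a *m X *m (step (@dbszego C) n w a)^T) =
  rmat 'i z w (step (@szego C) n z a *m X *m (step (@szego C) n w a)^T) -
  step (@szego C) n z a *m rmat 'i z w X *m (step (@szego C) n w a)^T.
Proof.
move=> zw; have [r0|r0] := eqVneq (rho a n) 0.
  (* Then 1 / rho = 0 as well: the factors L vanish, and so does the weight. *)
  by rewrite /step r0 invr0 expr0n; exact: scaled_sandwich0.
have n2 : 2 != 0 :> C by rewrite pnatr_eq0.
have s0 : 1 - a n * conjc (a n) != 0.
  by rewrite -(sqr_rho r0) fmorph_eq0 expf_neq0.
rewrite (sqr_rho r0) /step; exact: szego_sklyanin_scaled.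
Qed.

(** Induction on the number of factors, m being fixed: the terms with k <> n
    are those of T_n conjugated by the new factor, the term k = n is the bracket
    of the new factor alone, and the middle terms cancel. *)
Lemma transfer_sklyanin m n z w a X : z != w -> (n <= m)%N ->
  \sum_(k < m) bracket_term n z w a X k =
  rmat 'i z w (transfer n z a *m X *m (transfer n w a)^T) -
  transfer n z a *m rmat 'i z w X *m (transfer n w a)^T.
Proof.
move=> zw; elim: n => [|n IHn] nm.
  rewrite big1 => [|k _].
    by rewrite /= trmx1 !mulmx1 !mul1mx subrr.
  by rewrite /bracket_term /= !mul0mx subrr scaler0.
set L := step (@szego C) n; set Y := transfer n z a *m X *m (transfer n w a)^T.
have termE k : bracket_term n.+1 z w a X k =
    L z a *m bracket_term n z w a X k *m (L w a)^T +
    (if k == n then ('i * (rho a n ^+ 2)%:C) *: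
      (step (@dbszego C) n z a *m Y *m (step (@dszego C) n w a)^T -
       step (@dszego C) n z a *m Y *m (step (@dbszego C) n w a)^T) else 0).
  rewrite /bracket_term /=; case: eqP => [->|_].
    rewrite !(dtransfer_ge _ _ _ (leqnn n)) sandwich0 add0r.
    by rewrite 2!sandwichM.
  by rewrite addr0 sandwich_skew.
under eq_bigr do rewrite termE.
rewrite big_split /= -mulmx_suml -mulmx_sumr.
rewrite (IHn (ltnW nm)) -/Y.
rewrite (bigD1 (Ordinal nm)) //= eqxx big1 ?addr0 => [|k /negPf kn]; last first.
  by move: kn; rewrite -val_eqE /= => ->.
by rewrite step_sklyanin // sandwich_cancel -sandwichM.
Qed.

(** The bracket of two linear combinations of entries of a row of T_n(z) and of
    a row of T_n(w) is an entry of the Sklyanin relation at X = u v^T. *)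
Lemma poisson_transfer m n z w a (u v : 'cV[C]_2) i j : z != w -> (n <= m)%N ->
  poisson m (fun x => (transfer n z x *m u) i 0)
    (fun x => (transfer n w x *m v) j 0) a =
  (rmat 'i z w (transfer n z a *m (u *m v^T) *m (transfer n w a)^T) -
   transfer n z a *m rmat 'i z w (u *m v^T) *m (transfer n w a)^T) i j.
Proof.
move=> zw nm; rewrite -(transfer_sklyanin _ _ zw nm) summxE /poisson mulr_sumr.
apply: eq_bigr => k _; rewrite mulrA.
(* When rho_k = 0 the derivatives with respect to alpha_k need not exist, but
   they come with the weight rho_k^2. *)
have [r0|r0] := eqVneq (rho a k) 0.
  by rewrite /bracket_term r0 expr0n /= mulr0 mul0r scale0r mxE.
have lin y (t : 'cV[C]_2) l : wirtinger k a (fun x => (transfer n y x *m t) l 0)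
    ((dtransfer (@dszego C) n y k a *m t) l 0)
    ((dtransfer (@dbszego C) n y k a *m t) l 0).
  have ct : wirtinger_mx k a (fun=> t) 0 0 by exact: wirtinger_mx_cst.
  have := wirtinger_mxM (wirtinger_transfer n y r0) ct l 0.
  by rewrite !mulmx0 !addr0.
rewrite !(wirtinger_d_alpha (lin _ _ _)) !(wirtinger_d_alphabar (lin _ _ _)).
have outer (A B : 'M[C]_2) :
    (A *m (u *m v^T) *m B^T) i j = (A *m u) i 0 * (B *m v) j 0.
  by rewrite mulmxA -mulmxA -trmx_mul mxE big_ord1 [_^T _ _]mxE.
rewrite /bracket_term [RHS]mxE; congr (_ * _).
by rewrite [RHS]mxE [X in _ = _ + X]mxE !outer.
Qed.

End Transfer.

(** * The Szego recurrence as a product of matrices *)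

Section Szego.
Variable R : realType.
Local Notation C := R[i].
Implicit Types (a : nat -> C) (z w : C).

Lemma size_revpoly n (P : {poly C}) : (size (revpoly n P) <= n.+1)%N.
Proof. exact: size_poly. Qed.

Lemma size_Phi n a : (size (Phi n a) <= n.+1)%N.
Proof.
elim: n => [|n IHn] /=; first by rewrite size_poly1.
apply: leq_trans (size_polyD _ _) _; rewrite geq_max size_polyN.
apply/andP; split.
  rewrite mulrC; apply: leq_trans (size_polyMleq _ _) _.
  by rewrite size_polyX addn2.
by apply: leq_trans (size_scale_leq _ _) _; apply: leqW; exact: size_revpoly.
Qed.

(** Let P^* be the reversal of P at length n.  For P of degree at most n, the
    reversal at length n + 1 exchanges X P and P^*, and it is antilinear. *)
Lemma revpoly_szego n (P : {poly C}) (b : C) : (size P <= n.+1)%N ->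
  revpoly n.+1 ('X * P - conjc b *: revpoly n P) = revpoly n P - b *: ('X * P).
Proof.
move=> sP; apply/polyP => j.
rewrite coef_poly coefB coefZ coefXM coef_poly.
rewrite [in RHS]coefB coefZ coefXM coef_poly.
case: j => [|j] /=; first by rewrite !subn0 ltnn !mulr0 !subr0.
rewrite subSS !ltnS leq_subr.
case: ltngtP => [jn|nj|->].
- rewrite subKn 1?ltnW // subn_eq0 leqNgt jn /=.
  by rewrite [LHS]rmorphB rmorphM /= !conjcK -subnS.
- by rewrite [P`_j]nth_default ?mulr0 ?subr0 // (leq_trans sP).
- by rewrite subnn subn0 eqxx !sub0r [LHS]rmorphN rmorphM /= !conjcK.
Qed.

Lemma Phi_S n a :
  Phi n.+1 a = 'X * Phi n a - conjc (a n) *: revpoly n (Phi n a).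
Proof. by []. Qed.

Lemma Psi_S n a :
  Psi n.+1 a = 'X * Psi n a + conjc (a n) *: revpoly n (Psi n a).
Proof. by rewrite /Psi Phi_S [conjc _]rmorphN scaleNr opprK. Qed.

Lemma revpoly_Phi_S n a :
  revpoly n.+1 (Phi n.+1 a) = revpoly n (Phi n a) - a n *: ('X * Phi n a).
Proof. by rewrite Phi_S revpoly_szego // size_Phi. Qed.

Lemma revpoly_Psi_S n a :
  revpoly n.+1 (Psi n.+1 a) = revpoly n (Psi n a) + a n *: ('X * Psi n a).
Proof. by rewrite /Psi revpoly_Phi_S scaleNr opprK. Qed.

Lemma normalization_S n a :
  normalization n.+1 a = ((rho a n)^-1)%:C * normalization n a.
Proof. by rewrite /normalization big_ord_recr /= rmorphM mulrC. Qed.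

(** Changing the sign of the coefficients turns the recurrence of (phi, phi^* )
    into that of (psi, psi^* ), which is the first one for (psi, - psi^* );
    hence the initial column (1, -1). *)
Lemma transfer_phi n z a :
  [/\ phi n z a = transfer n z a 0 0 + transfer n z a 0 1,
      phistar n z a = transfer n z a 1 0 + transfer n z a 1 1,
      psi n z a = transfer n z a 0 0 - transfer n z a 0 1 &
      psistar n z a = transfer n z a 1 1 - transfer n z a 1 0].
Proof.
elim: n => [|n [IH1 IH2 IH3 IH4]].
  have rev1 : revpoly 0 1 = 1 :> {poly C}.
    by apply/polyP => -[|j]; rewrite coef_poly !coef1 // [LHS]rmorph1.
  rewrite /phi /phistar /psi /psistar /normalization big_ord0 /Psi /= rev1.
  by rewrite hornerC !mxE /=; split; ring.
rewrite /phi /phistar /psi /psistar normalization_S.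
rewrite revpoly_Phi_S revpoly_Psi_S Phi_S Psi_S !hornerE.
rewrite /= !mulmx2E !mxE /=.
move: IH1 IH2 IH3 IH4; rewrite /phi /phistar /psi /psistar.
set N := normalization n a; set r := ((rho a n)^-1)%:C.
have comb (x u v p q : C) : N * p = u -> N * q = v -> 
  r * N * (p + x * q) = r * (u + x * v) by move=> <- <-; ring.
move: ((Phi n a).[z]) ((revpoly n (Phi n a)).[z]) ((Psi n a).[z])
  ((revpoly n (Psi n a)).[z]) => p q p' q' IH1 IH2 IH3 IH4.
split.
- transitivity (r * (z * (N * p) - conjc (a n) * (N * q))); first by ring.
  by rewrite IH1 IH2; ring.
- transitivity (r * ((N * q) - a n * (z * (N * p)))); first by ring.
  by rewrite IH1 IH2; ring.
- transitivity (r * (z * (N * p') + conjc (a n) * (N * q'))); first by ring.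
  by rewrite IH3 IH4; ring.
- transitivity (r * ((N * q') + a n * (z * (N * p')))); first by ring.
  by rewrite IH3 IH4; ring.
Qed.

Lemma phi_transfer n z :
  phi n z = fun a => (transfer n z a *m col2 1 1) 0 0.
Proof.
apply/funext => a; have [-> _ _ _] := transfer_phi n z a.
by rewrite mulmx_col2 !mulr1.
Qed.

Lemma phistar_transfer n z :
  phistar n z = fun a => (transfer n z a *m col2 1 1) 1 0.
Proof.
apply/funext => a; have [_ -> _ _] := transfer_phi n z a.
by rewrite mulmx_col2 !mulr1.
Qed.

Lemma psi_transfer n z :
  psi n z = fun a => (transfer n z a *m col2 1 (-1)) 0 0.
Proof.
apply/funext => a; have [_ _ -> _] := transfer_phi n z a.
by rewrite mulmx_col2 mulr1 mulrN1.
Qed.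

Lemma psistar_transfer n z :
  psistar n z = fun a => (transfer n z a *m col2 (-1) 1) 1 0.
Proof.
apply/funext => a; have [_ _ _ ->] := transfer_phi n z a.
by rewrite mulmx_col2 mulr1 mulrN1 addrC.
Qed.

End Szego.

Unset Implicit Arguments.
Set Strict Implicit.

(** * The brackets *)

Theorem proposition2p5 (R : realType) (n : nat)
  (mu : probability (plane R) R) (mu_circle : mu (@unit_circle R) = 1%E)
  (alpha : nat -> R[i]) (mu_alpha : verblunsky mu alpha)
  (pb : ((nat -> R[i]) -> R[i]) -> ((nat -> R[i]) -> R[i]) ->
        (nat -> R[i]) -> R[i])
  (cases :
     (exists N : nat,
        [/\ supp mu #= `I_N, (n.+1 <= N)%N & pb = @poisson_finite R N]) \/
     (exists p : nat,
        [/\ infinite_set (supp mu), forall k, alpha (k + p)%N = alpha k,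
            ~~ odd p, (n.+1 <= p)%N & pb = @poisson_periodic R p]))
  (z w : R[i]) (zw : z <> w) :
  let phi_ x := phi n x alpha in
  let psi_ x := psi n x alpha in
  let phis_ x := phistar n x alpha in
  let psis_ x := psistar n x alpha in
  [/\ pb (phi n z) (phi n w) alpha = - pb (psi n z) (psi n w) alpha /\
      - pb (psi n z) (psi n w) alpha =
        'i / 4 * (phi_ z * psi_ w - phi_ w * psi_ z),
      pb (phi n z) (phistar n w) alpha =
        'i / 4 * (phi_ z * (phis_ w - psis_ w) + (phi_ z - psi_ z) * phis_ w)
        + 'i * w / (z - w) * (phi_ z * phis_ w - phi_ w * phis_ z),
      pb (psi n z) (psistar n w) alpha =
        'i / 4 * (psi_ z * (psis_ w - phis_ w) + (psi_ z - phi_ z) * psis_ w)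
        + 'i * w / (z - w) * (psi_ z * psis_ w - psi_ w * psis_ z),
      pb (phi n z) (psi n w) alpha =
        - ('i * w) / (z - w) * (phi_ z * psi_ w - phi_ w * psi_ z)
        - 'i / 2 * (phi_ z - psi_ z) * (phi_ w + psi_ w)
        + 'i / 4 * (phi_ z * phi_ w - psi_ z * psi_ w) &
      pb (phi n z) (psistar n w) alpha =
        'i / 4 * ((phi_ z - psi_ z) * phis_ w - psi_ z * (phis_ w - psis_ w))
        - 'i * w / (z - w) * (psi_ z * phis_ w - psi_ w * phis_ z)].
Proof.
have zw' : z != w by apply/eqP.
have zw0 : z - w != 0 by rewrite subr_eq0.
have [m nm ->] : exists2 m, (n <= m)%N & pb = @poisson R m.
  case: cases => [[N [_ nN ->]]|[p [_ _ _ np ->]]].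
    by exists N.-1; rewrite // -ltnS (ltn_predK nN).
  by exists p; rewrite // ltnW.
cbv zeta.
have [pz qz p'z q'z] := transfer_phi n z alpha.
have [pw qw p'w q'w] := transfer_phi n w alpha.
rewrite !(pz, qz, p'z, q'z, pw, qw, p'w, q'w).
rewrite !(phi_transfer, phistar_transfer, psi_transfer, psistar_transfer).
have P00 u0 u1 v0 v1 :=
  poisson_transfer alpha (col2 u0 u1) (col2 v0 v1) 0 0 zw' nm.
have P01 u0 u1 v0 v1 :=
  poisson_transfer alpha (col2 u0 u1) (col2 v0 v1) 0 1 zw' nm.
move: (transfer n z alpha) (transfer n w alpha) P00 P01 => S T P00 P01.
have com := rmat_commutatorE 'i z w S T.
have E00 u0 u1 v0 v1 := etrans (P00 u0 u1 v0 v1) (com u0 u1 v0 v1).1.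
have E01 u0 u1 v0 v1 := etrans (P01 u0 u1 v0 v1) (com u0 u1 v0 v1).2.
rewrite !E00 !E01 !mulmx_col2.
(* The entries of the transfer matrices and the imaginary unit are now
   indeterminates. *)
move: {com P00 P01 E00 E01} ('i : R[i]) => c.
by split; first split; field.
Qed.
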